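(* The quotient group $QI(\mathbb{R}_+)/H$ is left-orderable.
   Context: $\mathbb{R}_+=[0,\infty)$. $QI(\mathbb{R}_+)$ is the group (under composition) of quasi-isometries $\mathbb{R}_+\to\mathbb{R}_+$ modulo the relation of being at bounded distance (two maps $f,g$ are equivalent if $\sup_x|f(x)-g(x)|<\infty$); $[f]$ denotes the class of $f$. $H=\{[f]\in QI(\mathbb{R}_+):\lim_{x\to\infty}f(x)/x=1\}$, a normal subgroup of $QI(\mathbb{R}_+)$. A group $\Gamma$ is left-orderable if it admits a total order $\le$ such that $g\le h$ implies $fg\le fh$ for all $f,g,h\in\Gamma$. *)

(* Defs.v *)
From HB Require Import structures.
From mathcomp Require Import all_boot all_order all_algebra.
From mathcomp Require Import all_classical all_reals all_analysis.
From mathcomp Require Import lra.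
Set Implicit Arguments.
Unset Strict Implicit.
Unset Printing Implicit Defensive.
Import Order.TTheory GRing.Theory Num.Theory.
Import numFieldNormedType.Exports.

Local Open Scope classical_set_scope.
Local Open Scope quotient_scope.
Local Open Scope ring_scope.

Definition left_orderable (G : groupType) : Prop :=
  exists le : rel G,
    [/\ reflexive le, antisymmetric le, transitive le & total le] /\
    (forall f g h : G, le g h -> le (f * g)%g (f * h)%g).

Record normal_subgroup (G : groupType) := NormalSubgroup {
  nsub_set :> set G;
  nsub1 : nsub_set 1%g;
  nsubM : forall x y, nsub_set x -> nsub_set y -> nsub_set (x * y)%g;
  nsubV : forall x, nsub_set x -> nsub_set (x^-1)%g;
  nsubJ : forall x y, nsub_set x -> nsub_set (x ^ y)%g }.

Section QuotientGroup.
Variables (G : groupType) (N : normal_subgroup G).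
Implicit Types x y z : G.

(* The quotient G / N, as the type of cosets x N. *)
Definition coset_eq : rel G := fun x y => `[< nsub_set N (x^-1 * y)%g >].

Lemma coset_eq_refl : reflexive coset_eq.
Proof. by move=> x; apply/asboolP; rewrite mulVg; exact: nsub1. Qed.

Lemma coset_eq_sym : symmetric coset_eq.
Proof.
by move=> x y; apply/asboolP/asboolP => /nsubV; rewrite invgM invgK.
Qed.

Lemma coset_eq_trans : transitive coset_eq.
Proof.
move=> y x z /asboolP xy /asboolP yz; apply/asboolP.
by have := nsubM xy yz; rewrite -mulgA mulVKg.
Qed.

Canonical coset_equiv : equiv_rel G :=
  EquivRel coset_eq coset_eq_refl coset_eq_sym coset_eq_trans.

Definition quotient_group : Type := {eq_quot coset_equiv}.

HB.instance Definition _ := Choice.on quotient_group.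
HB.instance Definition _ : EqQuotient _ coset_equiv quotient_group :=
  EqQuotient.on quotient_group.

Definition qg_one : quotient_group := \pi_quotient_group (1%g : G).
Definition qg_mul (a b : quotient_group) : quotient_group :=
  \pi_quotient_group (repr a * repr b)%g.
Definition qg_inv (a : quotient_group) : quotient_group :=
  \pi_quotient_group ((repr a)^-1)%g.

Lemma qg_eqP x y :
  \pi_quotient_group x = \pi_quotient_group y <-> nsub_set N (x^-1 * y)%g.
Proof. by split => [/eqmodP/asboolP|?]; last exact/eqmodP/asboolP. Qed.

Lemma qg_mulE x y :
  qg_mul (\pi_quotient_group x) (\pi_quotient_group y) =
  \pi_quotient_group (x * y)%g.
Proof.
rewrite /qg_mul; case: piP => x' /qg_eqP xx'; case: piP => y' /qg_eqP yy'.
apply/esym/qg_eqP.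
have -> : ((x * y)^-1 * (x' * y') = (x^-1 * x') ^ y * (y^-1 * y'))%g.
  by rewrite conjgE invgM !mulgA mulgK.
exact: nsubM (nsubJ _ xx') yy'.
Qed.

Lemma qg_invE x :
  qg_inv (\pi_quotient_group x) = \pi_quotient_group (x^-1)%g.
Proof.
rewrite /qg_inv; case: piP => x' /qg_eqP xx'; apply/qg_eqP; rewrite invgK.
have -> : (x' * x^-1 = (x^-1 * x') ^ x^-1)%g.
  by rewrite conjgE invgK !mulgA mulgV mul1g.
exact: nsubJ.
Qed.

Lemma qg_mulA : associative qg_mul.
Proof.
move=> a b c; elim/quotW: a => x; elim/quotW: b => y; elim/quotW: c => z.
by rewrite (qg_mulE y z) (qg_mulE x y) !qg_mulE mulgA.
Qed.

Lemma qg_mul1 : left_id qg_one qg_mul.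
Proof. by move=> a; elim/quotW: a => x; rewrite qg_mulE mul1g. Qed.

Lemma qg_mulr1 : right_id qg_one qg_mul.
Proof. by move=> a; elim/quotW: a => x; rewrite qg_mulE mulg1. Qed.

Lemma qg_mulV : left_inverse qg_one qg_inv qg_mul.
Proof. by move=> a; elim/quotW: a => x; rewrite qg_invE qg_mulE mulVg. Qed.

Lemma qg_mulrV : right_inverse qg_one qg_inv qg_mul.
Proof. by move=> a; elim/quotW: a => x; rewrite qg_invE qg_mulE mulgV. Qed.

HB.instance Definition _ := isGroup.Build quotient_group
  qg_mulA qg_mul1 qg_mulr1 qg_mulV qg_mulrV.

End QuotientGroup.

Section QuasiIsometries.
Variable R : realType.
Local Notation Rplus := {nonneg R}.
Implicit Types (x y z : Rplus) (f g : Rplus -> Rplus).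

Definition dist x y : R := `|x%:num - y%:num|.

Definition quasi_isometry f : Prop :=
  exists K C : R, [/\ 1 <= K, 0 <= C,
    forall x y, K^-1 * dist x y - C <= dist (f x) (f y) <= K * dist x y + C
    & forall y, exists x, dist (f x) y <= C].

Definition bounded_distance f g : Prop :=
  exists M : R, forall x, dist (f x) (g x) <= M.

(* For x >= 0, `|x|%:nng is x seen in [0, +oo[. *)
Definition asymptotic_to_id f : Prop :=
  ((f `|x|%:nng)%:num / x) @[x --> +oo] --> (1 : R).

Lemma dist_ge0 x y : 0 <= dist x y. Proof. exact: normr_ge0. Qed.
Lemma distC x y : dist x y = dist y x. Proof. exact: distrC. Qed.
Lemma dist_refl x : dist x x = 0. Proof. by rewrite /dist subrr normr0. Qed.
Lemma dist_tri y x z : dist x z <= dist x y + dist y z.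
Proof. exact: ler_distD. Qed.

(* Division-free form of the lower bound. *)
Lemma quasi_isometryP f : quasi_isometry f <->
  exists K C : R, [/\ 1 <= K, 0 <= C,
    forall x y, dist (f x) (f y) <= K * dist x y + C,
    forall x y, dist x y <= K * dist (f x) (f y) + C
    & forall y, exists x, dist (f x) y <= C].
Proof.
split=> [[K [C [K1 C0 H S]]]|[K [C [K1 C0 H H' S]]]].
  have K0 : 0 < K by apply: lt_le_trans K1.
  have CK : C <= K * C by rewrite ler_peMl.
  exists K, (K * C); split => //; first by rewrite mulr_ge0 // ltW.
  - by move=> x y; have /andP[_ h] := H x y; lra.
  - move=> x y; have /andP[h _] := H x y.
    rewrite -mulrDr -ler_pdivrMl //; lra.
  - by move=> y; have [x h] := S y; exists x; lra.
have K0 : 0 < K by apply: lt_le_trans K1.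
exists K, C; split => // x y; rewrite H andbT.
rewrite lerBlDr ler_pdivrMl // mulrDr.
have CK : C <= K * C by rewrite ler_peMl.
have := H' x y; lra.
Qed.

Lemma quasi_isometry_id : quasi_isometry id.
Proof.
apply/quasi_isometryP; exists 1, 0; split=> // [x y|x y|y].
- by rewrite mul1r addr0.
- by rewrite mul1r addr0.
- by exists y; rewrite dist_refl.
Qed.

Lemma quasi_isometry_comp f g :
  quasi_isometry f -> quasi_isometry g -> quasi_isometry (f \o g).
Proof.
move=> /quasi_isometryP[K [C [K1 C0 H H' S]]].
move=> /quasi_isometryP[L [D [L1 D0 I I' T]]].
have K0 : 0 < K by apply: lt_le_trans K1.
have L0 : 0 < L by apply: lt_le_trans L1.
have KD0 : 0 <= K * D by rewrite mulr_ge0 // ltW.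
have LC0 : 0 <= L * C by rewrite mulr_ge0 // ltW.
apply/quasi_isometryP; exists (K * L), (K * D + L * C + D + C + C).
split => //; rewrite /comp.
- by rewrite mulr_ege1.
- by rewrite !addr_ge0.
- move=> x y; have := H (g x) (g y).
  have : K * dist (g x) (g y) <= K * (L * dist x y + D) by rewrite ler_pM2l.
  rewrite mulrDr mulrA; lra.
- move=> x y; have := I' x y.
  have : L * dist (g x) (g y) <= L * (K * dist (f (g x)) (f (g y)) + C).
    by rewrite ler_pM2l.
  rewrite mulrDr mulrA [L * K]mulrC; lra.
- move=> y; have [z hz] := S y; have [x hx] := T z; exists x.
  have := dist_tri (f z) (f (g x)) y; have := H (g x) z.
  have : K * dist (g x) z <= K * D by rewrite ler_pM2l.
  lra.
Qed.

Lemma quasi_inverse f : quasi_isometry f ->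
  exists g, [/\ quasi_isometry g, bounded_distance (f \o g) id
             & bounded_distance (g \o f) id].
Proof.
move=> /quasi_isometryP[K [C [K1 C0 H H' S]]].
have K0 : 0 < K by apply: lt_le_trans K1.
have [g gP] := choice S.
have KC0 : 0 <= K * C by rewrite mulr_ge0 // ltW.
have gf x : dist (g (f x)) x <= K * C + C.
  have := H' (g (f x)) x; have := gP (f x) => h.
  have : K * dist (f (g (f x))) (f x) <= K * C by rewrite ler_pM2l.
  lra.
exists g; split; last 2 first.
- by exists C.
- by exists (K * C + C).
apply/quasi_isometryP; exists K, (K * C + K * C + C + C + C).
split => //; first by rewrite !addr_ge0.
- move=> x y; have h := H' (g x) (g y).
  have : dist (f (g x)) (f (g y)) <= dist x y + (C + C).
    have := dist_tri x (f (g x)) (f (g y)); have := dist_tri y x (f (g y)).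
    have := gP x; have := gP y; rewrite [dist y _]distC; lra.
  rewrite -(ler_pM2l K0) !mulrDr; lra.
- move=> x y; have h := H (g x) (g y).
  have := dist_tri (f (g x)) x y; have := dist_tri (f (g y)) (f (g x)) y.
  have := gP x; have := gP y; rewrite [dist x (f _)]distC; lra.
- by move=> x; exists (f x); have := gf x; lra.
Qed.

Lemma bounded_distance_comp f f' g g' : quasi_isometry f ->
  bounded_distance f f' -> bounded_distance g g' ->
  bounded_distance (f \o g) (f' \o g').
Proof.
move=> /quasi_isometryP[K [C [K1 C0 H _ _]]] [M HM] [P HP].
have K0 : 0 < K by apply: lt_le_trans K1.
exists (K * P + C + M) => x /=.
have := dist_tri (f (g' x)) (f (g x)) (f' (g' x)).
have := H (g x) (g' x); have := HM (g' x).
have : K * dist (g x) (g' x) <= K * P by rewrite ler_pM2l.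
lra.
Qed.

Record qisom := QIsom {
  qisom_fun :> Rplus -> Rplus;
  qisom_prop : `[< quasi_isometry qisom_fun >] }.

HB.instance Definition _ := [isSub for qisom_fun].
HB.instance Definition _ := [Choice of qisom by <:].

Lemma qisomP (f : qisom) : quasi_isometry f.
Proof. by apply/asboolP; exact: qisom_prop. Qed.

Definition qisom_id : qisom := QIsom (asboolT quasi_isometry_id).
Definition qisom_comp (f g : qisom) : qisom :=
  QIsom (asboolT (quasi_isometry_comp (qisomP f) (qisomP g))).

Definition qisom_eq : rel qisom := fun u v => `[< bounded_distance u v >].

Lemma qisom_eq_refl : reflexive qisom_eq.
Proof. by move=> f; apply/asboolP; exists 0 => x; rewrite dist_refl. Qed.

Lemma qisom_eq_sym : symmetric qisom_eq.
Proof.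
by move=> f g; apply/asboolP/asboolP => -[M HM]; exists M => x; rewrite distC.
Qed.

Lemma qisom_eq_trans : transitive qisom_eq.
Proof.
move=> g f h /asboolP[M HM] /asboolP[P HP]; apply/asboolP.
exists (M + P) => x; exact: le_trans (dist_tri (g x) _ _) (lerD _ _).
Qed.

Canonical qisom_equiv : equiv_rel qisom :=
  EquivRel qisom_eq qisom_eq_refl qisom_eq_sym qisom_eq_trans.

Definition QI : Type := {eq_quot qisom_equiv}.

HB.instance Definition _ := Choice.on QI.
HB.instance Definition _ : EqQuotient _ qisom_equiv QI := EqQuotient.on QI.

Lemma QI_eqP (f g : qisom) : \pi_QI f = \pi_QI g <-> bounded_distance f g.
Proof. by split => [/eqmodP/asboolP|?]; last exact/eqmodP/asboolP. Qed.

Lemma qisom_inv_ex (f : qisom) : exists g : qisom,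
  bounded_distance (f \o g) id /\ bounded_distance (g \o f) id.
Proof.
have [g [qg fg gf]] := quasi_inverse (qisomP f).
by exists (QIsom (asboolT qg)).
Qed.

Definition qisom_inv (f : qisom) : qisom := projT1 (cid (qisom_inv_ex f)).

Lemma qisom_invP (f : qisom) :
  bounded_distance (f \o qisom_inv f) id /\
  bounded_distance (qisom_inv f \o f) id.
Proof. by rewrite /qisom_inv; case: cid. Qed.

Definition QI_one : QI := \pi_QI qisom_id.
Definition QI_mul (a b : QI) : QI := \pi_QI (qisom_comp (repr a) (repr b)).
Definition QI_inv (a : QI) : QI := \pi_QI (qisom_inv (repr a)).

Lemma QI_mulE (f g : qisom) :
  QI_mul (\pi_QI f) (\pi_QI g) = \pi_QI (qisom_comp f g).
Proof.
rewrite /QI_mul; case: piP => f' /QI_eqP ff'; case: piP => g' /QI_eqP gg'.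
by apply/esym/QI_eqP; apply: bounded_distance_comp => //; exact: qisomP.
Qed.

Lemma QI_mulA : associative QI_mul.
Proof.
move=> a b c; elim/quotW: a => f; elim/quotW: b => g; elim/quotW: c => h.
by rewrite (QI_mulE g h) (QI_mulE f g) !QI_mulE; congr (\pi_QI _); exact/val_inj.
Qed.

Lemma QI_mul1 : left_id QI_one QI_mul.
Proof.
by move=> a; elim/quotW: a => f; rewrite QI_mulE; congr (\pi_QI _); exact/val_inj.
Qed.

Lemma QI_mulr1 : right_id QI_one QI_mul.
Proof.
by move=> a; elim/quotW: a => f; rewrite QI_mulE; congr (\pi_QI _); exact/val_inj.
Qed.

Lemma QI_mulV : left_inverse QI_one QI_inv QI_mul.
Proof.
move=> a; rewrite -{2}[a]reprK (QI_mulE (qisom_inv (repr a)) (repr a)).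
by apply/QI_eqP; exact: (qisom_invP (repr a)).2.
Qed.

Lemma QI_mulrV : right_inverse QI_one QI_inv QI_mul.
Proof.
move=> a; rewrite -{1}[a]reprK (QI_mulE (repr a) (qisom_inv (repr a))).
by apply/QI_eqP; exact: (qisom_invP (repr a)).1.
Qed.

HB.instance Definition _ := isGroup.Build QI
  QI_mulA QI_mul1 QI_mulr1 QI_mulV QI_mulrV.

Definition Rplus0 : Rplus := 0%:nng.

Lemma dist0 x : dist x Rplus0 = x%:num.
Proof. by rewrite /dist /= subr0 ger0_norm. Qed.

Definition sublinear f : Prop := forall e : R, 0 < e ->
  exists2 A : R, 0 <= A & forall x, dist (f x) x <= e * x%:num + A.

Lemma asymptotic_to_idP f : quasi_isometry f ->
  asymptotic_to_id f <-> sublinear f.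
Proof.
move=> /quasi_isometryP[K [C [K1 C0 H _ _]]].
have K0 : 0 < K by apply: lt_le_trans K1.
split=> [fid e e0|fsub].
  have /cvgrPdist_le/(_ e e0)[A [_ HA]] := fid.
  pose B := Num.max A 0.
  have B0 : 0 <= B by rewrite le_max lexx orbT.
  have KB0 : 0 <= K * B by rewrite mulr_ge0 // ltW.
  have d0 := dist_ge0 (f Rplus0) Rplus0.
  exists (K * B + C + dist (f Rplus0) Rplus0 + B); first by rewrite !addr_ge0.
  move=> x; have ex0 : 0 <= e * x%:num by rewrite mulr_ge0 // ltW.
  have [xB|Bx] := leP x%:num B.
    have h1 := dist_tri (f Rplus0) (f x) x.
    have h2 := dist_tri Rplus0 (f Rplus0) x.
    have h3 := H x Rplus0.
    have h4 : K * x%:num <= K * B by rewrite ler_pM2l.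
    move: h2 h3; rewrite [dist Rplus0 x]distC !dist0; lra.
  have x0 : 0 < x%:num by apply: le_lt_trans Bx.
  have Ax : A < x%:num by apply: le_lt_trans Bx; rewrite le_max lexx.
  have := HA _ Ax.
  have -> : `|x%:num|%:nng = x by apply/val_inj; rewrite /= ger0_norm.
  have -> : 1 - (f x)%:num / x%:num = (x%:num - (f x)%:num) / x%:num.
    by rewrite mulrBl divff // gt_eqF.
  rewrite normrM normfV (gtr0_norm x0) ler_pdivrMr // -/(dist _ _) distC.
  lra.
apply/cvgrPdist_le => e e0.
have e2 : 0 < e / 2 by rewrite divr_gt0.
have [A A0 HA] := fsub _ e2.
near=> x.
have x0 : 0 < x by near: x; exact: nbhs_pinfty_gt.
have xE : (`|x|%:nng : Rplus)%:num = x by rewrite /= gtr0_norm.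
set y : Rplus := `|x|%:nng.
have {}xE : y%:num = x by [].
have := HA y.
have -> : 1 - (f y)%:num / x = (x - (f y)%:num) / x.
  by rewrite mulrBl divff // gt_eqF.
rewrite normrM normfV (gtr0_norm x0) ler_pdivrMr // distrC /dist xE => /le_trans; apply.
have : A / (e / 2) <= x by near: x; apply: nbhs_pinfty_ge; exact: num_real.
rewrite ler_pdivrMr //; lra.
Unshelve. all: by end_near.
Qed.

Definition QI_H_set : set QI :=
  [set \pi_QI f | f in [set f : qisom | asymptotic_to_id f]].

Lemma sublinear_le (f g : Rplus -> Rplus) (p : Rplus -> Rplus) (K C : R) :
  0 < K -> sublinear f -> 0 <= C -> (forall x, (p x)%:num <= K * x%:num + C) ->
  (forall x, dist (g x) x <= K * dist (f (p x)) (p x) + C) -> sublinear g.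
Proof.
move=> K0 fs C0 Hp Hg e e0.
have eK : 0 < e / K / K by rewrite !divr_gt0.
have [A A0 HA] := fs _ eK.
have KA0 : 0 <= K * A by rewrite mulr_ge0 // ltW.
have eC : 0 <= e / K * C by rewrite mulr_ge0 // divr_ge0 // ltW.
exists (e / K * C + K * A + C) => [|x]; first by rewrite !addr_ge0.
have h1 : K * dist (f (p x)) (p x) <= K * (e / K / K * (p x)%:num + A).
  by rewrite ler_pM2l.
have h2 : e / K * (p x)%:num <= e / K * (K * x%:num + C).
  by rewrite ler_pM2l // divr_gt0.
have E1 : K * (e / K / K * (p x)%:num) = e / K * (p x)%:num.
  by rewrite mulrA [K * _]mulrC divfK // gt_eqF.
have E2 : e / K * (K * x%:num) = e * x%:num.
  by rewrite mulrA divfK // gt_eqF.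
move: h1 h2; rewrite !mulrDr E1 E2; have := Hg x; lra.
Qed.

Lemma sublinear_bounded f g :
  bounded_distance f g -> sublinear f -> sublinear g.
Proof.
move=> [M HM] fs e e0; have [A A0 HA] := fs e e0.
have M0 : 0 <= M by apply: le_trans (HM Rplus0); exact: dist_ge0.
exists (A + M) => [|x]; first by rewrite addr_ge0.
by have := dist_tri (f x) (g x) x; have := HM x; have := HA x;
   rewrite [dist (g x) (f x)]distC; lra.
Qed.

Lemma QI_H_setE (f : qisom) : QI_H_set (\pi_QI f) <-> sublinear f.
Proof.
split=> [[g /= gid /QI_eqP gf]|fs].
  by apply: sublinear_bounded gf _; apply/asymptotic_to_idP => //; exact: qisomP.
by exists f => //=; apply/asymptotic_to_idP => //; exact: qisomP.
Qed.

Lemma QI_oneE : (1%g : QI) = \pi_QI qisom_id. Proof. by []. Qed.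

Lemma QI_mulgE (f g : qisom) :
  (\pi_QI f * \pi_QI g)%g = \pi_QI (qisom_comp f g).
Proof. exact: QI_mulE. Qed.

Lemma QI_invgE (f : qisom) : ((\pi_QI f)^-1)%g = \pi_QI (qisom_inv f).
Proof.
apply: (mulgI (\pi_QI f)); rewrite mulgV QI_mulgE QI_oneE.
by apply/esym/QI_eqP; exact: (qisom_invP f).1.
Qed.

Lemma QI_H_one : QI_H_set 1%g.
Proof.
rewrite QI_oneE; apply/QI_H_setE => e e0; exists 0 => // x.
by rewrite dist_refl addr0 mulr_ge0 // ltW.
Qed.

Lemma QI_H_mul (a b : QI) : QI_H_set a -> QI_H_set b -> QI_H_set (a * b)%g.
Proof.
rewrite -[a]reprK -[b]reprK QI_mulgE => /QI_H_setE fs /QI_H_setE gs.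
apply/QI_H_setE => e e0; move: fs gs.
set f : qisom := repr a; set g : qisom := repr b => fs gs.
have /quasi_isometryP[K [C [K1 C0 H _ _]]] := qisomP f.
have K0 : 0 < K by apply: lt_le_trans K1.
have [A A0 HA] := fs (e / 2) ltac:(by rewrite divr_gt0).
have [B B0 HB] := gs (e / 2 / K) ltac:(by rewrite !divr_gt0).
have KB0 : 0 <= K * B by rewrite mulr_ge0 // ltW.
exists (K * B + C + A) => [|x]; first by rewrite !addr_ge0.
have := dist_tri (f x) (f (g x)) x; have := H (g x) x; have := HA x.
have : K * dist (g x) x <= K * (e / 2 / K * x%:num + B) by rewrite ler_pM2l.
have E : K * (e / 2 / K * x%:num) = e / 2 * x%:num.
  by rewrite mulrA [K * _]mulrC divfK // gt_eqF.
rewrite mulrDr E /=; lra.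
Qed.

Lemma QI_H_inv (a : QI) : QI_H_set a -> QI_H_set (a^-1)%g.
Proof.
rewrite -[a]reprK QI_invgE => /QI_H_setE fs; apply/QI_H_setE; move: fs.
set f : qisom := repr a => fs.
have [_ [M HM]] := qisom_invP f.
have /quasi_isometryP[K [C [K1 C0 H _ _]]] := qisomP (qisom_inv f).
have K0 : 0 < K by apply: lt_le_trans K1.
have M0 : 0 <= M by apply: le_trans (HM Rplus0); exact: dist_ge0.
apply: (@sublinear_le f _ id K (C + M)) => //; first by rewrite addr_ge0.
  move=> x /=.
  have : x%:num <= K * x%:num by rewrite ler_peMl.
  lra.
move=> x /=; have := dist_tri (qisom_inv f (f x)) (qisom_inv f x) x.
have := H x (f x); have := HM x => /=; rewrite [dist x (f x)]distC; lra.
Qed.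

Lemma QI_H_conj (a b : QI) : QI_H_set a -> QI_H_set (a ^ b)%g.
Proof.
rewrite conjgE -[a]reprK -[b]reprK QI_invgE (QI_mulgE (repr a) (repr b)).
rewrite QI_mulgE => /QI_H_setE fs.
apply/QI_H_setE; move: fs.
set f : qisom := repr a; set p : qisom := repr b => fs.
have [_ [M HM]] := qisom_invP p.
have /quasi_isometryP[K [C [K1 C0 H _ _]]] := qisomP (qisom_inv p).
have /quasi_isometryP[L [D [L1 D0 I _ _]]] := qisomP p.
have K0 : 0 < K by apply: lt_le_trans K1.
have L0 : 0 < L by apply: lt_le_trans L1.
have M0 : 0 <= M by apply: le_trans (HM Rplus0); exact: dist_ge0.
have p00 : 0 <= (p Rplus0)%:num by [].
apply: (@sublinear_le f _ p (K + L) (C + M + D + (p Rplus0)%:num)) => //.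
- by rewrite addr_gt0.
- by rewrite !addr_ge0.
- move=> x; have := I x Rplus0; rewrite dist0.
  have : (p x)%:num - (p Rplus0)%:num <= dist (p x) (p Rplus0).
    exact: ler_norm.
  have : 0 <= K * x%:num by rewrite mulr_ge0 // ltW.
  rewrite mulrDl; lra.
- move=> x /=.
  have := dist_tri (qisom_inv p (p x)) (qisom_inv p (f (p x))) x.
  have := H (f (p x)) (p x); have := HM x => /=.
  have : 0 <= L * dist (f (p x)) (p x).
    by rewrite mulr_ge0 ?dist_ge0 // ltW.
  rewrite mulrDl; lra.
Qed.

Definition QI_H : normal_subgroup QI := NormalSubgroup QI_H_one QI_H_mul QI_H_inv QI_H_conj.

End QuasiIsometries.

(* Main.v *)
Require Import Defs.
From mathcomp Require Import all_boot all_order all_algebra.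
From mathcomp Require Import all_classical all_reals all_analysis.
From mathcomp Require Import lra.
Import Order.TTheory GRing.Theory Num.Theory.

Set Implicit Arguments.
Unset Strict Implicit.
Unset Printing Implicit Defensive.

Local Open Scope classical_set_scope.
Local Open Scope quotient_scope.
Local Open Scope ring_scope.

(** The group [QI(R_+)/H] carries many left-invariant total preorders, and they
    separate its points; refining them into one another yields a left-invariant
    total order.

    The preorders come from ultrafilters [U] on [0, +oo[ that contain all the
    neighbourhoods of infinity. Put [f <=_U g] when, for every [e > 0], the
    inequality [f x <= g x + e * x] holds for [U]-almost every [x]; in other
    words, compare the limits of [f x / x] and [g x / x] along [U].
    - This is a total preorder because [U] is an ultrafilter.
    - It only depends on classes modulo [H]: two quasi-isometries agree modulo
      [H] exactly when they differ by [o(x)] (lemma [pi_eqP]).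
    - It is invariant under [g |-> f \o g] because a quasi-isometry of the half
      line is coarsely increasing (lemma [quasi_isometry_homo]), with a
      Lipschitz control that turns an error [e * x] into an error [K * e * x]
      up to a constant (lemma [asymp_le_comp]).
    - If [f] and [g] do not differ by [o(x)], then [|f x - g x| > e * x] on an
      unbounded set for some [e], and an ultrafilter that contains this set
      separates [f] from [g] (lemma [asymp_le_separated]).

    In geometric terms, [f] acts on the asymptotic cone of the half line along
    [U] by an increasing homeomorphism, and [<=_U] compares the images of the
    point [1].

    The passage from a separating family of preorders to a single order
    ([separating_left_orderable]) is the usual lexicographic argument, with
    Zorn's lemma in place of a well-ordering of the family. *)

(** * Left orders from separating preorders *)

Definition invariant_preorder (G : groupType) (le : G -> G -> Prop) : Prop :=
  [/\ forall x y, le x y \/ le y x,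
      forall y x z, le x y -> le y z -> le x z &
      forall a x y, le x y -> le (a * x)%g (a * y)%g].

Definition lexi (G : Type) (le1 le2 : G -> G -> Prop) (x y : G) : Prop :=
  le1 x y /\ (le1 y x -> le2 x y).

(** Left invariance of the lexicographic refinement uses inverses: a tie
    between [a * x] and [a * y] for [le1] comes from a tie between [x] and
    [y]. *)
Lemma lexi_preorder (G : groupType) (le1 le2 : G -> G -> Prop) :
  invariant_preorder le1 -> invariant_preorder le2 ->
  invariant_preorder (lexi le1 le2).
Proof.
move=> [tot1 tr1 inv1] [tot2 tr2 inv2]; split.
- move=> x y; have [xy|nxy] := pselect (le1 x y); last first.
    by right; split => [|/nxy //]; have [/nxy|] := tot1 x y.
  have [yx|nyx] := pselect (le1 y x); last by left; split.
  by have [] := tot2 x y; [left|right].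
- move=> y x z [xy xy2] [yz yz2]; split; first exact: tr1 xy yz.
  by move=> zx; apply: (tr2 y); [apply/xy2/(tr1 z)|apply/yz2/(tr1 x)].
- move=> a x y [xy xy2]; split; first exact: inv1.
  by move=> /(inv1 a^-1%g); rewrite !mulKg => /xy2; exact: inv2.
Qed.

(** Order the invariant preorders by refinement. A chain of them is bounded by
    its intersection, which is still total: if a member of the chain refuses
    [x <= y], then it has [y < x], and so do all its refinements, while the
    members that it refines have [y <= x]. A finest preorder [m] is
    antisymmetric, for otherwise a preorder that separates two tied elements
    would refine it further. *)
Lemma separating_left_orderable (G : groupType) :
  (forall x y : G, x <> y ->
     exists le, invariant_preorder le /\ ~ (le x y /\ le y x)) ->
  left_orderable G.
Proof.
move=> sep.
pose T := {le : G -> G -> Prop | invariant_preorder le}.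
pose finer : rel T := fun s t => `[< forall x y, sval t x y -> sval s x y >].
have triv : invariant_preorder (fun _ _ : G => True) by split => //; left.
have [||C Ctot|m mmax] := @ZL_preorder T (exist _ _ triv) finer.
- by move=> t; apply/asboolP.
- by move=> r s t /asboolP rs /asboolP st; apply/asboolP => x y /st /rs.
- pose inter x y := forall s, C s -> sval s x y.
  suff interP : invariant_preorder inter.
    by exists (exist _ inter interP) => s Cs; apply/asboolP => x y; exact.
  split=> [x y|y x z xy yz s Cs|a x y xy s Cs].
  + have [|/existsNP[s /not_implyP[Cs nxy]]] := pselect (inter x y).
      by left.
    right=> t Ct; have [tots _ _] := svalP s; have [tott _ _] := svalP t.
    have yx : sval s y x by have [/nxy|] := tots x y.
    have [/asboolP ts|/asboolP st] := Ctot _ _ Ct Cs; first exact: ts.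
    by have [/st/nxy|] := tott x y.
  + by have [_ tr _] := svalP s; exact: tr (xy s Cs) (yz s Cs).
  + by have [_ _ inv] := svalP s; exact/inv/xy.
have [tot tr inv] := svalP m.
have anti x y : sval m x y -> sval m y x -> x = y.
  move=> xy yx; apply: contrapT => /sep[le [leP nle]].
  have lP := lexi_preorder (svalP m) leP.
  have /asboolP lm : finer (exist _ _ lP) m.
    by apply: mmax; apply/asboolP => u v [].
  by apply: nle; split; [apply: (lm _ _ xy).2|apply: (lm _ _ yx).2].
exists (fun x y => `[< sval m x y >]); split; first split.
- by move=> x; apply/asboolP; have [] := tot x x.
- by move=> x y /andP[/asboolP xy /asboolP yx]; exact: anti.
- by move=> y x z /asboolP xy /asboolP yz; apply/asboolP; exact: tr xy yz.
- by move=> x y; have [xy|yx] := tot x y; apply/orP; [left|right]; apply/asboolP.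
- by move=> a x y /asboolP xy; apply/asboolP; exact: inv.
Qed.

(** * Quasi-isometries of the half line at infinity *)

Section Asymptotics.
Variable R : realType.
Local Notation Rplus := {nonneg R}.
Implicit Types (x y z : Rplus) (f g h : Rplus -> Rplus).

(** Discrete intermediate value argument. Suppose that [x <= y] and
    [f y < f x], and walk from [y] to the right by unit steps. The values of
    [f] start below [f x] and end above it, as [f] is proper, and they move by
    at most [K + C] at each step; hence some [z >= y] has [f z] within [K + C]
    of [f x]. Then [z], and a fortiori [y], is at bounded distance from
    [x]. *)
Lemma quasi_isometry_homo f : quasi_isometry f ->
  exists C : R, forall x y, x%:num <= y%:num -> (f x)%:num <= (f y)%:num + C.
Proof.
move=> /quasi_isometryP[K [C [K1 C0 H H' _]]].
have K0 : 0 < K by apply: lt_le_trans K1.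
pose D := K * (K + C) + C.
have D0 : 0 <= D by rewrite addr_ge0// mulr_ge0 ?addr_ge0 // ltW.
exists (K * D + C) => x y xy.
have KD0 : 0 <= K * D by rewrite mulr_ge0 // ltW.
have [|fyx] := leP (f x)%:num (f y)%:num; first lra.
have zn0 (n : nat) : 0 <= y%:num + n%:R by rewrite addr_ge0.
pose z (n : nat) : Rplus := NngNum (zn0 n).
have zE n : (z n)%:num = y%:num + n%:R by [].
have [n fzn] : exists n, (f x)%:num <= (f (z n))%:num.
  have fx0 : 0 <= (f x)%:num by [].
  have [n Hn] : exists n : nat, K * ((f x)%:num + (f x)%:num) + C < n%:R.
    exists (Num.bound (K * ((f x)%:num + (f x)%:num) + C)).
    by rewrite archi_boundP // addr_ge0 // mulr_ge0 ?addr_ge0 // ltW.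
  (* otherwise [f (z n)] and [f y] both lie in [0, f x], although [z n] and
     [y] are far apart *)
  exists n; rewrite leNgt; apply/negP => fzx.
  have := H' (z n) y; rewrite {1}/dist zE addrC addKr ger0_norm //.
  have : K * dist (f (z n)) (f y) <= K * ((f x)%:num + (f x)%:num).
    have a0 : 0 <= (f (z n))%:num by [].
    have b0 : 0 <= (f y)%:num by [].
    rewrite ler_pM2l // /dist ler_norml; lra.
  lra.
have exP : exists n, (f x)%:num <= (f (z n))%:num by exists n.
case: (ex_minnP exP) => -[|k] fzk kmin.
  have z0 : z 0%N = y by apply/val_inj; rewrite /= addr0.
  by move: fzk; rewrite z0; lra.
have fzk' : (f (z k))%:num < (f x)%:num.
  by rewrite ltNge; apply/negP => /kmin; rewrite ltnn.
have stepE : dist (z k.+1) (z k) = 1.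
  by rewrite /dist !zE -natr1 addrA [_ + k%:R + 1]addrC addrK normr1.
have jump : dist (f (z k.+1)) (f x) <= K + C.
  have := H (z k.+1) (z k); rewrite stepE mulr1 {1}/dist => /ler_normlP[_ h].
  rewrite /dist ger0_norm; lra.
have near_x : dist (z k.+1) x <= D.
  apply: le_trans (H' _ _) _; rewrite lerD2r ler_pM2l //.
have xyD : dist x y <= D.
  move: near_x; rewrite /dist zE [`|x%:num - _|]distrC => /ler_normlP[_].
  have k0 : 0 <= k.+1%:R :> R by [].
  rewrite ger0_norm; lra.
have := H x y => /ler_normlP[_].
have : K * dist x y <= K * D by rewrite ler_pM2l.
lra.
Qed.

Definition Rplus_infty : set_system Rplus := (fun x : R => `|x|%:nng) @ +oo.

#[local] Instance Rplus_infty_proper : ProperFilter Rplus_infty.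
Proof. exact: fmap_proper_filter. Qed.

Lemma Rplus_infty_ge (A : R) : \forall x \near Rplus_infty, A <= x%:num.
Proof.
suff : \forall x \near +oo, A <= `|x| by [].
near=> x; apply: le_trans (ler_norm x).
by near: x; apply: nbhs_pinfty_ge; exact: num_real.
Unshelve. all: by end_near. Qed.

(** [f x - g x = o(x)]. *)
Definition asymp_eq f g : Prop := forall e : R, 0 < e ->
  \forall x \near Rplus_infty, dist (f x) (g x) <= e * x%:num.

(** For quasi-isometries and an ultrafilter [F] that tends to infinity, this is
    [lim_F (f x / x) <= lim_F (g x / x)], in a form that avoids taking the
    limits. *)
Definition asymp_le (F : set_system Rplus) f g : Prop := forall e : R, 0 < e ->
  \forall x \near F, (f x)%:num <= (g x)%:num + e * x%:num.

(** The constant is absorbed by [e / 2 * x] as soon as [x >= A / (e / 2)]. *)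
Lemma affine_asymp_eq f g : (forall e : R, 0 < e ->
    exists A : R, forall x, dist (f x) (g x) <= e * x%:num + A) ->
  asymp_eq f g.
Proof.
move=> fg e e0; have e2 : 0 < e / 2 by rewrite divr_gt0.
have [A HA] := fg _ e2; near=> x.
have : A / (e / 2) <= x%:num by near: x; exact: Rplus_infty_ge.
rewrite ler_pdivrMr //; have := HA x; lra.
Unshelve. all: by end_near. Qed.

Lemma bounded_asymp_eq f g : bounded_distance f g -> asymp_eq f g.
Proof.
move=> [M HM]; apply: affine_asymp_eq => e e0; exists M => x.
have ex0 : 0 <= e * x%:num by rewrite mulr_ge0 // ltW.
by have := HM x; lra.
Qed.

Lemma asymp_eq_sym f g : asymp_eq f g -> asymp_eq g f.
Proof. by move=> fg e e0; apply: filterS (fg e e0) => x; rewrite distC. Qed.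

Lemma asymp_eq_trans g f h : asymp_eq f g -> asymp_eq g h -> asymp_eq f h.
Proof.
move=> fg gh e e0; have e2 : 0 < e / 2 by rewrite divr_gt0.
near=> x; have := dist_tri (g x) (f x) (h x).
have : dist (f x) (g x) <= e / 2 * x%:num by near: x; exact: fg.
have : dist (g x) (h x) <= e / 2 * x%:num by near: x; exact: gh.
lra.
Unshelve. all: by end_near. Qed.

Lemma asymp_eq_comp f g h : quasi_isometry f ->
  asymp_eq g h -> asymp_eq (f \o g) (f \o h).
Proof.
move=> /quasi_isometryP[K [C [K1 C0 H _ _]]] gh e e0.
have K0 : 0 < K by apply: lt_le_trans K1.
have e2 : 0 < e / 2 by rewrite divr_gt0.
near=> x; have := H (g x) (h x).
have : K * dist (g x) (h x) <= e / 2 * x%:num.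
  rewrite mulrC -ler_pdivlMr // mulrAC.
  by near: x; apply: gh; rewrite divr_gt0.
have : C / (e / 2) <= x%:num by near: x; exact: Rplus_infty_ge.
rewrite ler_pdivrMr //=; lra.
Unshelve. all: by end_near. Qed.

Lemma asymp_eq_idP f : quasi_isometry f -> asymp_eq f id <-> sublinear f.
Proof.
move=> qf; split=> [fid|fs]; last first.
  by apply: affine_asymp_eq => e /fs[A _ HA]; exists A.
apply/asymptotic_to_idP => //; apply/cvgrPdist_le => e e0.
have : \forall x \near +oo, dist (f `|x|%:nng) `|x|%:nng <= e * `|x| :=
  fid e e0.
move=> fe; near=> x.
have x0 : 0 < x by near: x; exact: nbhs_pinfty_gt.
set y : Rplus := `|x|%:nng.
have yE : y%:num = x by rewrite /= gtr0_norm.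
have -> : 1 - (f y)%:num / x = (x - (f y)%:num) / x.
  by rewrite mulrBl divff // gt_eqF.
rewrite normrM normfV (gtr0_norm x0) ler_pdivrMr // distrC.
suff : dist (f y) y <= e * y%:num by rewrite /dist yE.
by rewrite /y; near: x.
Unshelve. all: by end_near. Qed.

Section AlongFilter.
Variables (F : set_system Rplus).
Hypotheses (FF : ProperFilter F) (Finfty : Rplus_infty `<=` F).

Lemma asymp_le_trans g f h : asymp_le F f g -> asymp_le F g h -> asymp_le F f h.
Proof.
move=> fg gh e e0; have e2 : 0 < e / 2 by rewrite divr_gt0.
near=> x.
have : (f x)%:num <= (g x)%:num + e / 2 * x%:num by near: x; exact: fg.
have : (g x)%:num <= (h x)%:num + e / 2 * x%:num by near: x; exact: gh.
lra.
Unshelve. all: by end_near. Qed.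

Lemma asymp_eq_le f g : asymp_eq f g -> asymp_le F f g.
Proof.
move=> fg e e0; apply: Finfty; apply: filterS (fg e e0) => x.
by move=> /ler_normlP[_]; lra.
Qed.

(** Where [g x <= h x], coarse monotonicity compares [f (g x)] with [f (h x)];
    elsewhere [g x] exceeds [h x] by at most [e / 2 / K * x], which [f] expands
    by a factor at most [K], up to a constant. *)
Lemma asymp_le_comp f g h : quasi_isometry f ->
  asymp_le F g h -> asymp_le F (f \o g) (f \o h).
Proof.
move=> qf gh e e0; have [D HD] := quasi_isometry_homo qf.
have /quasi_isometryP[K [C [K1 C0 H _ _]]] := qf.
have K0 : 0 < K by apply: lt_le_trans K1.
have e2 : 0 < e / 2 by rewrite divr_gt0.
near=> x.
have xge : Num.max C D / (e / 2) <= x%:num.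
  by near: x; apply: Finfty; exact: Rplus_infty_ge.
move: xge; rewrite ler_pdivrMr // ge_max => /andP[xC xD] /=.
have ex0 : 0 <= e / 2 * x%:num by rewrite mulr_ge0 // ltW.
have [/HD|hg] := leP (g x)%:num (h x)%:num; first lra.
have : K * dist (g x) (h x) <= e / 2 * x%:num.
  rewrite mulrC -ler_pdivlMr // mulrAC /dist gtr0_norm ?subr_gt0 // lerBlDl.
  by near: x; apply: gh; rewrite divr_gt0.
have /ler_normlP[_] := H (g x) (h x); lra.
Unshelve. all: by end_near. Qed.

End AlongFilter.

(** If [f <= g + e * x] fails on a set of [U] for one [e], then [g < f] there,
    which is better than [g <= f + d * x] for every [d]. *)
Lemma asymp_le_total (U : set_system Rplus) f g : UltraFilter U ->
  asymp_le U f g \/ asymp_le U g f.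
Proof.
move=> UU; have [|/existsNP[e /not_implyP[e0 nfg]]] :=
  pselect (asymp_le U f g); first by left.
right=> d d0; have [//|] := in_ultra_setVsetC
  [set x | (f x)%:num <= (g x)%:num + e * x%:num] UU.
apply: filterS => x /= /negP; rewrite -ltNge.
have : 0 <= e * x%:num by rewrite mulr_ge0 // ltW.
have : 0 <= d * x%:num by rewrite mulr_ge0 // ltW.
lra.
Qed.

Lemma asymp_le_separated f g : ~ asymp_eq f g ->
  exists U : set_system Rplus, [/\ UltraFilter U, Rplus_infty `<=` U &
    ~ (asymp_le U f g /\ asymp_le U g f)].
Proof.
move=> /existsNP[e /not_implyP[e0 nfg]].
pose S := [set x | e * x%:num < dist (f x) (g x)].
have SF : ProperFilter (within S Rplus_infty).
  apply: Build_ProperFilter_ex => P; rewrite /within /= => SP.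
  apply: contrapT => /forallNP nP; apply: nfg.
  by apply: filterS SP => x SP; rewrite leNgt; apply/negP => /SP /nP.
have [U [UU SU]] := ultraFilterLemma SF.
exists U; split => //.
  by move=> P infP; apply: SU; rewrite /within /=; apply: filterS infP.
move=> [/(_ e e0) fg /(_ e e0) gf].
have US : U S by apply: SU; rewrite /within /=; exact: nearW.
have [x [[Sx fgx] gfx]] := filter_ex (filterI (filterI US fg) gf).
move: Sx; rewrite /S /= ltNge => /negP; apply.
rewrite /dist ler_norml; lra.
Qed.

End Asymptotics.

(** * The ultrafilter preorders on the quotient *)

Section Quotient.
Variable R : realType.
Local Notation Q := (quotient_group (QI_H R)).

Definition rep (a : Q) : qisom R := repr (repr a).

Lemma repK (a : Q) : a = \pi_Q (\pi_(QI R) (rep a)).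
Proof. by rewrite /rep !reprK. Qed.

(** The class of [f^-1 * g] lies in [H] when [f^-1 \o g] differs from the
    identity by [o(x)]; composing with [f], or with its quasi-inverse, moves
    [f] to the other side since quasi-isometries preserve [o(x)] errors. *)
Lemma pi_eqP (f g : qisom R) :
  \pi_Q (\pi_(QI R) f) = \pi_Q (\pi_(QI R) g) <-> asymp_eq f g.
Proof.
have [ffV fVf] := qisom_invP f.
have qV := qisomP (qisom_inv f).
apply: iff_trans (qg_eqP _ _ _) _; rewrite QI_invgE QI_mulgE.
apply: iff_trans (QI_H_setE _) _.
apply: iff_trans (iff_sym (asymp_eq_idP (qisomP _))) _ => /=; split=> fg.
- apply: (@asymp_eq_trans _ (f \o (qisom_inv f \o g))).
    exact/asymp_eq_sym/(asymp_eq_comp (qisomP f) fg).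
  by apply: bounded_asymp_eq; have [M HM] := ffV; exists M => x; exact: HM.
- apply: (@asymp_eq_trans _ (qisom_inv f \o f)); last exact: bounded_asymp_eq.
  exact: asymp_eq_comp qV (asymp_eq_sym fg).
Qed.

Lemma repM (a b : Q) : asymp_eq (rep (a * b)%g) (rep a \o rep b).
Proof.
apply/(pi_eqP _ (qisom_comp (rep a) (rep b))).
by rewrite -repK -QI_mulgE -qg_mulE -!repK.
Qed.

Lemma asymp_le_invariant (U : set_system {nonneg R}) : UltraFilter U ->
  @Rplus_infty R `<=` U ->
  invariant_preorder (fun a b : Q => asymp_le U (rep a) (rep b)).
Proof.
move=> UU Uinf; split=> [a b|b a c|a b c bc]; first exact: asymp_le_total.
  exact: asymp_le_trans.
have FU : ProperFilter U by exact: ultra_proper.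
have abc := asymp_le_comp FU Uinf (qisomP (rep a)) bc.
apply: (asymp_le_trans FU (asymp_eq_le Uinf (repM a b))).
exact: (asymp_le_trans FU abc (asymp_eq_le Uinf (asymp_eq_sym (repM a c)))).
Qed.

End Quotient.

Theorem theorem1p2 (R : realType) : left_orderable (quotient_group (QI_H R)).
Proof.
apply: separating_left_orderable => a b ab.
have [|U [UU Uinf nle]] := @asymp_le_separated R (rep a) (rep b).
  by move=> /pi_eqP; rewrite -!repK.
by exists (fun a b => asymp_le U (rep a) (rep b)); split => //;
  exact: asymp_le_invariant.
Qed.
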